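(* For every quantum state $\rho_A$, its (non-conditional) computational min-entropy satisfies $$\overset{c}{H}_{\min}(A)_\rho=-\log\sup_{\tau_A\in\mathcal S^{p(n)}_{n,A}}\mathrm{Tr}\bigl[\rho_A\,\tau_A^{\mathsf T}\bigr]=:-\log\|\rho_A\|_{\infty,\mathrm{comp}},$$ where $\mathcal S^{p(n)}_{n,A}$ is the set of efficiently preparable states on $A$ and $\mathsf T$ denotes the transpose in the computational basis.
   Context: All Hilbert spaces are finite-dimensional and $\log$ is base $2$. Fix a finite gate set $\mathcal G$ (each gate is a unitary acting on a bounded number of registers) and a polynomial $p$. For a fixed $n$, $A$ and $B$ are systems consisting of registers, $d_A=\dim\mathcal H_A$, $A'\cong A$, and $|\Omega_{AA'}\rangle=\frac1{\sqrt{d_A}}\sum_{x}|x\rangle_A|x\rangle_{A'}$ in the computational basis. For a quantum channel (CPTP map) $T:\mathcal B(\mathcal H_B)\to\mathcal B(\mathcal H_{A'})$ with adjoint $T^*$ ($\mathrm{Tr}[T(\rho)X]=\mathrm{Tr}[\rho T^*(X)]$), the gate complexity $C(T)$ is the minimal number of gates from $\mathcal G$ in a unitary circuit $U:\mathcal H_B\otimes\mathcal H_E\to\mathcal H_{A'}\otimes\mathcal H_K$ (for some ancillary systems $E,K$ of matching total dimension) such that $T(\rho)=\mathrm{tr}_K[U(\rho\otimes|0\rangle\langle0|_E)U^*]$ for all $\rho$. $T$ is efficient if $C(T)\le p(n)$. The Choi operator is $J(T^* ):=d_A(\mathrm{Id}_A\otimes T^* )(|\Omega_{AA'}\rangle\langle\Omega_{AA'}|)$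 on $AB$. Let $\mathbf J:=\{J(T^* ):C(T)\le p(n)\}$ and $\mathcal C^{E}:=\mathrm{cone}(\mathbf J)$ the smallest convex cone containing it. Standing assumption (informational completeness): $\mathrm{span}_{\mathbb R}\mathbf J=\{X\text{ Hermitian on }AB:\mathrm{tr}_A[X]\in\mathbb R\cdot\mathbb 1_B\}$. For Hermitian $X,Y$ on $AB$ write $X\le_{S}Y$ iff $\mathrm{Tr}[XF]\le\mathrm{Tr}[YF]$ for all $F\in\mathcal C^{E}$. Then $\overset{c}{D}{}^{A|B}_{\max}(\rho\|\sigma):=\inf\{\lambda\in\mathbb R:\rho\le_S2^\lambda\sigma\}$ (with $\inf\emptyset=+\infty$) and $\overset{c}{H}_{\min}(A|B)_\rho:=-\inf_{\sigma_B\ge0,\mathrm{Tr}[\sigma_B]=1}\overset{c}{D}{}^{A|B}_{\max}(\rho_{AB}\|\mathbb 1_A\otimes\sigma_B)$. Non-conditional case: let $B$ be one-dimensional, spanned by $|1\rangle_B$, put $\hat\rho_{AB}:=\rho_A\otimes|1\rangle\langle1|_B$ and define $\overset{c}{H}_{\min}(A)_\rho:=\overset{c}{H}_{\min}(A|B)_{\hat\rho}$. The set $\mathcal S^{p(n)}_{n,A}$ consists of all states $\tau_A=\Lambda(|1\rangle\langle1|_B)$ with $\Lambda$ an efficient CPTP map from the one-dimensional system $B$ to $A\cong A'$. *)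

(* Defs.v *)
From HB Require Import structures.
From mathcomp Require Import all_boot all_order all_algebra.
From mathcomp Require Import complex.
From mathcomp Require Import boolp classical_sets reals ereal exp.

Set Implicit Arguments.
Unset Strict Implicit.
Unset Printing Implicit Defensive.

Import Order.TTheory GRing.Theory Num.Theory.

Local Open Scope classical_set_scope.
Local Open Scope ring_scope.
Local Open Scope complex_scope.
Local Open Scope sesquilinear_scope.

(* The register i has dimension (lvl i).+1 and computational basis
   |0>, ..., |lvl i>; no register has dimension 0, and |0> always exists. *)
Record system := System { reg :> finType; lvl : reg -> nat }.

Definition cbasis (S : system) := {dffun forall i : reg S, 'I_(lvl i).+1}.

Definition hdim (S : system) : nat := #|cbasis S|.

Definition tensor (S T : system) : system :=
  @System (reg S + reg T)%type
    (fun i => match i with inl j => lvl j | inr k => lvl k end).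

(* |x>|y> as a computational basis vector of the composite system. *)
Definition glue (S T : system) (x : cbasis S) (y : cbasis T) :
    cbasis (tensor S T) :=
  [ffun i : tensor S T => match i return 'I_(@lvl (tensor S T) i).+1 with
                          | inl j => x j
                          | inr k => y k
                          end].

Definition lpart (S T : system) (z : cbasis (tensor S T)) : cbasis S :=
  [ffun j : S => z (inl j) : 'I_(lvl j).+1].

Definition rpart (S T : system) (z : cbasis (tensor S T)) : cbasis T :=
  [ffun k : T => z (inr k) : 'I_(lvl k).+1].

(* An injective assignment of the registers of S to registers of W of the same
   dimension. *)
Record placement (S W : system) := Placement {
  place :> S -> W;
  place_inj : injective place;
  place_lvl : forall j, lvl (place j) = lvl j
}.

Definition pull (S W : system) (f : placement S W) (x : cbasis W) : cbasis S :=
  [ffun j : S => cast_ord (congr1 succn (place_lvl f j)) (x (f j))].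

Section Operators.
Context {R : realType}.
Local Notation C := R[i].

(* Linear maps H_T -> H_S, with entries in the computational bases. *)
Definition hom (S T : system) := 'M[C]_(hdim S, hdim T).
Definition op (S : system) := hom S S.

Definition entry (S T : system) (X : hom S T) (x : cbasis S) (y : cbasis T) : C :=
  X (enum_rank x) (enum_rank y).

Definition mkhom (S T : system) (f : cbasis S -> cbasis T -> C) : hom S T :=
  \matrix_(i, j) f (enum_val i) (enum_val j).

Definition ket (S : system) (x : cbasis S) : 'cV[C]_(hdim S) :=
  delta_mx (enum_rank x) 0.

Definition ketbra (S : system) (v : 'cV[C]_(hdim S)) : op S := v *m v ^t*.

Definition ket0 (S : system) : 'cV[C]_(hdim S) := ket [ffun i : S => ord0].

Definition tens (S T : system) (X : op S) (Y : op T) : op (tensor S T) :=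
  mkhom (fun z w => entry X (lpart z) (lpart w) * entry Y (rpart z) (rpart w)).

Definition ptrace1 (S T : system) (Z : op (tensor S T)) : op T :=
  mkhom (fun y y' => \sum_(x : cbasis S) entry Z (glue x y) (glue x y')).

Definition ptrace2 (S T : system) (Z : op (tensor S T)) : op S :=
  mkhom (fun x x' => \sum_(y : cbasis T) entry Z (glue x y) (glue x' y)).

(* Id_S (x) Phi, for a linear map Phi : B(H_T) -> B(H_U): Phi is applied to
   the blocks (<x| (x) 1) Z (|x'> (x) 1). *)
Definition id_tens (S T U : system) (Phi : op T -> op U)
    (Z : op (tensor S T)) : op (tensor S U) :=
  mkhom (fun z w =>
    entry (Phi (mkhom (fun y y' =>
             entry Z (glue (lpart z) y) (glue (lpart w) y'))))
          (rpart z) (rpart w)).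

Definition is_psd (S : system) (X : op S) : Prop :=
  X \is hermsymmx /\ forall v : 'cV[C]_(hdim S), 0 <= (v ^t* *m X *m v) 0 0.

Definition is_state (S : system) (rho : op S) : Prop :=
  is_psd rho /\ \tr rho = 1.

Definition is_channel (S T : system) (Phi : {linear op S -> op T}) : Prop :=
  (forall (Z : system) (X : op (tensor Z S)),
     is_psd X -> is_psd (id_tens Phi X)) /\
  (forall X, \tr (Phi X) = \tr X).

(* The formula is that of adjointP, tested on matrix units. *)
Definition adjoint (S T : system) (Phi : op S -> op T) (X : op T) : op S :=
  \matrix_(i, j) \tr (Phi (delta_mx j i) *m X).

Lemma adjointP (S T : system) (Phi : {linear op S -> op T}) (rho : op S)
    (X : op T) :
  \tr (Phi rho *m X) = \tr (rho *m adjoint Phi X).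
Proof.
rewrite [in LHS](matrix_sum_delta rho) linear_sum mulmx_suml linear_sum.
apply: eq_bigr => i _.
rewrite linear_sum mulmx_suml linear_sum !mxE; apply: eq_bigr => j _.
by rewrite linearZ -scalemxAl linearZ !mxE.
Qed.

Record gate := Gate {
  gate_sys : system;
  gate_mx : op gate_sys;
  gate_unitary : gate_mx \is unitarymx
}.

(* M acting on the registers f(S) of W, and trivially on the others. *)
Definition lift_op (S W : system) (f : placement S W) (M : op S) : op W :=
  mkhom (fun x y =>
    if [forall i : W, (i \notin codom f) ==> (x i == y i)]
    then entry M (pull f x) (pull f y) else 0).

(* For a bijective f : S -> W, the unitary H_W -> H_S that reads the wires of W
   as the wires of S. *)
Definition relabel (S W : system) (f : placement S W) : hom S W :=
  mkhom (fun x y => (x == pull f y)%:R).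

Section GateSet.
Context {I : finType} (G : I -> gate).

(* circuit W k U: the unitary U on W is a product of k gates. *)
Inductive circuit (W : system) : nat -> op W -> Prop :=
| circuit_nil : circuit 0 1%:M
| circuit_cons k U (g : I) (f : placement (gate_sys (G g)) W) :
    circuit k U -> circuit k.+1 (lift_op f (gate_mx (G g)) *m U).

(* At the output the wires of BE are regrouped into A and K. *)
Definition implements (B A : system) (Phi : {linear op B -> op A})
    (k : nat) : Prop :=
  exists (E K : system) (f : placement (tensor A K) (tensor B E))
         (V : op (tensor B E)),
    [/\ bijective f, circuit k V
      & forall rho : op B,
          let U : hom (tensor A K) (tensor B E) := relabel f *m V in
          Phi rho = ptrace2 (U *m tens rho (ketbra (ket0 E)) *m U ^t*)].

(* +oo when no circuit implements Phi. *)
Definition complexity (B A : system) (Phi : {linear op B -> op A}) : \bar R :=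
  ereal_inf [set k%:R%:E | k in [set k | implements Phi k]].

Context (p : {poly R}) (n : nat).

Definition efficient (B A : system) (Phi : {linear op B -> op A}) : Prop :=
  (complexity Phi <= p.[n%:R]%:E)%E.

(* |Omega_{AA'}>, with A' = A. *)
Definition Omega (A : system) : 'cV[C]_(hdim (tensor A A)) :=
  (sqrtC (hdim A)%:R)^-1 *: \sum_(x : cbasis A) ket (glue x x).

Definition choi (A B : system) (Phi : op A -> op B) : op (tensor A B) :=
  (hdim A)%:R *: id_tens Phi (ketbra (Omega A)).

Definition Jset (A B : system) : set (op (tensor A B)) :=
  [set J | exists Phi : {linear op B -> op A},
     [/\ is_channel Phi, efficient Phi & J = choi (adjoint Phi)]].

Definition convex_cone (S : system) (K : set (op S)) : Prop :=
  forall (X Y : op S) (s t : R), K X -> K Y -> 0 <= s -> 0 <= t ->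
    K (s%:C *: X + t%:C *: Y).

Definition cone (S : system) (X : set (op S)) : set (op S) :=
  smallest (@convex_cone S) X.

Definition real_subspace (S : system) (V : set (op S)) : Prop :=
  V 0 /\ forall (X Y : op S) (s t : R), V X -> V Y ->
    V (s%:C *: X + t%:C *: Y).

Definition real_span (S : system) (X : set (op S)) : set (op S) :=
  smallest (@real_subspace S) X.

Definition coneE (A B : system) : set (op (tensor A B)) := cone (@Jset A B).

Definition info_complete (A B : system) : Prop :=
  real_span (@Jset A B) =
  [set X | X \is hermsymmx /\ exists c : R, ptrace1 X = (c%:C)%:M].

Definition le_S (A B : system) (X Y : op (tensor A B)) : Prop :=
  forall F, coneE F -> \tr (X *m F) <= \tr (Y *m F).

Definition cDmax (A B : system) (rho sigma : op (tensor A B)) : \bar R :=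
  ereal_inf [set l%:E | l in
    [set l : R | le_S rho ((2 `^ l)%:C *: sigma)]].

Definition cHmin (A B : system) (rho : op (tensor A B)) : \bar R :=
  (- ereal_inf [set cDmax rho (tens 1%:M sigma) |
                sigma in [set sigma : op B | is_state sigma]])%E.

(* The non-conditional min-entropy; b is the basis vector |1> of the
   one-dimensional system B. *)
Definition cHmin_uncond (A B : system) (b : cbasis B) (rho : op A) : \bar R :=
  cHmin (tens rho (ketbra (ket b))).

Definition prep_states (A B : system) (b : cbasis B) : set (op A) :=
  [set tau | exists Phi : {linear op B -> op A},
     [/\ is_channel Phi, efficient Phi & tau = Phi (ketbra (ket b))]].

(* Tr[rho tau^T] is real for states, so Re only changes its type. *)
Definition comp_norm (A B : system) (b : cbasis B) (rho : op A) : \bar R :=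
  ereal_sup [set (complex.Re (\tr (rho *m tau^T)))%:E |
             tau in @prep_states A B b].

End GateSet.

End Operators.

(* log 0 = -oo and log +oo = +oo, as for lne. *)
Definition elog2 {R : realType} (x : \bar R) : \bar R :=
  (lne x * ((ln 2)^-1)%:E)%E.

Arguments gate R : clear implicits.
Arguments Jset {R I} G p n A B _.
Arguments coneE {R I} G p n A B _.
Arguments info_complete {R I} G p n A B.
Arguments prep_states {R I} G p n A {B} b _.

(* Main.v *)
(** Writing J for the Choi operator of the adjoint of a channel Phi from B to A,
    one has Tr[(X (x) Y) J] = Tr[X (Phi Y)^T].  When B is one-dimensional, its
    only state is |b><b|, and with Y = |b><b| and X = rho or X = 1 the
    inequality rho (x) |b><b| <=_S 2^l 1 (x) |b><b|, tested on the generators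
    of the cone, reads Tr[rho tau^T] <= 2^l for all efficiently preparable tau,
    that is, log of the supremum <= l.  The order on R[i] also compares
    imaginary parts, so Tr[rho tau^T] must be shown real; complete positivity
    applied to rho (x) |b><b| even gives that it is nonnegative. *)

Require Import Defs.
From mathcomp Require Import all_boot all_order all_algebra.
From mathcomp Require Import complex.
From mathcomp Require Import boolp classical_sets reals ereal exp.

Import Order.TTheory GRing.Theory Num.Theory.

Local Open Scope classical_set_scope.
Local Open Scope ring_scope.
Local Open Scope sesquilinear_scope.

(** * Basis vectors of composite systems *)

Lemma lpart_glue (S T : system) (x : cbasis S) (y : cbasis T) :
  lpart (glue x y) = x.
Proof. by apply/ffunP => i; rewrite !ffunE. Qed.

Lemma rpart_glue (S T : system) (x : cbasis S) (y : cbasis T) :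
  rpart (glue x y) = y.
Proof. by apply/ffunP => i; rewrite !ffunE. Qed.

Lemma glue_parts (S T : system) (z : cbasis (tensor S T)) :
  glue (lpart z) (rpart z) = z.
Proof. by apply/ffunP => -[i|i]; rewrite !ffunE. Qed.

Lemma hdim_gt0 (S : system) : (0 < hdim S)%N.
Proof. by apply/card_gt0P; exists [ffun=> ord0]. Qed.

Section Entries.
Context {R : realType}.
Local Notation C := R[i].
Local Notation hom := (@Defs.hom R).
Local Notation op := (@Defs.op R).

Lemma entry_mkhom (S T : system) (f : cbasis S -> cbasis T -> C) x y :
  entry (mkhom f) x y = f x y.
Proof. by rewrite /entry mxE !enum_rankK. Qed.

Lemma sum_hdim (S : system) (F : 'I_(hdim S) -> C) :
  \sum_i F i = \sum_(x : cbasis S) F (enum_rank x).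
Proof. exact/reindex/onW_bij/enum_rank_bij. Qed.

Lemma sum_cbasis_tensor (S T : system) (F : cbasis (tensor S T) -> C) :
  \sum_z F z = \sum_x \sum_y F (glue x y).
Proof.
rewrite pair_bigA /=; apply: reindex; apply: onW_bij.
exists (fun z : cbasis (tensor S T) => (lpart z, rpart z)) => [[x y]|z] /=.
  by rewrite lpart_glue rpart_glue.
exact: glue_parts.
Qed.

Lemma entryZ (S T : system) a (X : hom S T) x y :
  entry (a *: X : hom S T) x y = a * entry X x y.
Proof. exact: mxE. Qed.

Lemma entryM (S T U : system) (X : hom S T) (Y : hom T U) x z :
  entry (X *m Y : hom S U) x z = \sum_y entry X x y * entry Y y z.
Proof. by rewrite /entry mxE sum_hdim. Qed.

Lemma mxtrace_entry (S : system) (X : op S) : \tr X = \sum_x entry X x x.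
Proof. by rewrite /mxtrace sum_hdim. Qed.

Lemma mxtrace_delta (n : nat) (M : 'M[C]_n) i j : \tr (M *m delta_mx i j) = M j i.
Proof.
rewrite /mxtrace (bigD1 j) //= big1 ?addr0 => [|k kj]; rewrite !mxE.
  rewrite (bigD1 i) //= big1 ?addr0 => [|l /negPf li].
    by rewrite mxE !eqxx mulr1.
  by rewrite mxE li mulr0.
by rewrite big1 // => l _; rewrite mxE (negPf kj) andbF mulr0.
Qed.

Lemma entry_ketbra (S : system) (v : 'cV[C]_(hdim S)) x y :
  entry (ketbra v) x y = v (enum_rank x) 0 * (v (enum_rank y) 0)^*.
Proof. by rewrite /entry !mxE big_ord1 !mxE. Qed.

(** * Quadratic forms and positivity *)

Lemma quad_formE (S : system) (v : 'cV[C]_(hdim S)) (X : op S) :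
  (v ^t* *m X *m v) 0 0 =
  \sum_x \sum_y (v (enum_rank x) 0)^* * entry X x y * v (enum_rank y) 0.
Proof.
rewrite mxE sum_hdim [RHS]exchange_big; apply: eq_bigr => y _ /=.
rewrite mxE sum_hdim big_distrl; apply: eq_bigr => x _ /=.
by rewrite !mxE.
Qed.

Lemma hermP (S : system) (X : op S) :
  X \is hermsymmx <-> forall x y, entry X x y = (entry X y x)^*.
Proof.
split=> [/is_hermitianmxP hX x y|hX].
  by rewrite /entry [in LHS]hX expr0 scale1r !mxE.
apply/is_hermitianmxP/matrixP => i j; rewrite expr0 scale1r !mxE.
by have := hX (enum_val i) (enum_val j); rewrite /entry !enum_valK.
Qed.

(** The form at [v] equals the form of [X] at the contracted vector [v'], which is $(1 \otimes
    \langle u|)v$. *)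
Lemma psd_tens_ketbra (S T : system) (X : op S) (u : 'cV[C]_(hdim T)) :
  is_psd X -> is_psd (tens X (ketbra u)).
Proof.
move=> [/hermP hX pX]; split.
  apply/hermP => z w; rewrite !entry_mkhom !entry_ketbra hX !rmorphM /=.
  by rewrite conjCK; congr (_ * _); rewrite mulrC.
move=> v.
pose v' : 'cV[C]_(hdim S) := \col_i
  \sum_y (u (enum_rank y) 0)^* * v (enum_rank (glue (enum_val i) y)) 0.
suff -> : (v ^t* *m tens X (ketbra u) *m v) 0 0 = (v' ^t* *m X *m v') 0 0.
  exact: pX.
rewrite !quad_formE sum_cbasis_tensor; apply: eq_bigr => x _.
under eq_bigr do rewrite sum_cbasis_tensor.
rewrite exchange_big; apply: eq_bigr => x' _ /=.
rewrite !mxE !enum_rankK rmorph_sum /= mulr_suml mulr_suml.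
apply: eq_bigr => y _; rewrite mulr_sumr; apply: eq_bigr => y' _.
rewrite entry_mkhom entry_ketbra !lpart_glue !rpart_glue rmorphM /= conjCK.
rewrite -!mulrA; set a := entry X _ _; set c := v _ _; set d := u _ _.
by rewrite [RHS]mulrCA; congr (_ * _); rewrite mulrCA.
Qed.

Lemma psd_ketbra (S : system) (u : 'cV[C]_(hdim S)) : is_psd (ketbra u).
Proof.
split.
  by apply/hermP => x y; rewrite !entry_ketbra rmorphM /= conjCK mulrC.
move=> v; rewrite /ketbra !mulmxA -mulmxA mxE big_ord1.
(* The form factors as $\langle v,u\rangle\langle u,v\rangle = |\langle u,v\rangle|^2$. *)
suff -> : (v ^t* *m u) 0 0 = ((u ^t* *m v) 0 0)^*.
  by rewrite mulrC; exact: mul_conjC_ge0.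
rewrite !mxE rmorph_sum; apply: eq_bigr => i _.
by rewrite !mxE rmorphM /= conjCK mulrC.
Qed.

(** Each block of $X \otimes Y$ is an entry of [X] times [Y], and [Phi] commutes with this
    scalar. *)
Lemma id_tens_tens (S T U : system) (Phi : {linear op T -> op U})
    (X : op S) (Y : op T) :
  id_tens Phi (tens X Y) = tens X (Phi Y).
Proof.
apply/matrixP => i j; rewrite !mxE.
set a := entry X _ _.
have -> : mkhom (fun y y' => entry (tens X Y) (glue (lpart (enum_val i)) y)
            (glue (lpart (enum_val j)) y')) = a *: Y.
  apply/matrixP => k l.
  rewrite !mxE entry_mkhom !lpart_glue !rpart_glue.
  by rewrite {2}/entry !enum_valK.
by rewrite linearZ /entry mxE.
Qed.

(* The value is that of the form of [tens X Y] at sum_x |x>|x>. *)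
Lemma psd_tens_trace_ge0 (S : system) (X Y : op S) :
  is_psd (tens X Y) -> 0 <= \tr (X *m Y^T).
Proof.
pose v : 'cV[C]_(hdim (tensor S S)) :=
  \col_i (lpart (enum_val i) == rpart (enum_val i))%:R.
move=> [_ /(_ v)]; suff -> : (v ^t* *m tens X Y *m v) 0 0 = \tr (X *m Y^T) by [].
rewrite quad_formE sum_cbasis_tensor mxtrace_entry; apply: eq_bigr => x _; rewrite entryM.
rewrite (bigD1 x) //= [X in _ + X]big1 ?addr0 => [|y /negPf yx]; last first.
  apply: big1 => z _.
  by rewrite !mxE !enum_rankK lpart_glue rpart_glue eq_sym yx conjC0 !mul0r.
rewrite sum_cbasis_tensor; apply: eq_bigr => x' _.
rewrite (bigD1 x') //= [X in _ + X]big1 ?addr0 => [|y /negPf yx].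
  rewrite entry_mkhom !mxE !enum_rankK !lpart_glue !rpart_glue.
  by rewrite !eqxx conjC1 mul1r mulr1 /entry mxE.
by rewrite !mxE !enum_rankK !lpart_glue !rpart_glue eq_sym yx !mulr0.
Qed.

(** * The Choi operator of the adjoint *)

Lemma adjoint_scalable (S T : system) (Phi : op S -> op T) :
  scalable (adjoint Phi).
Proof.
by move=> a X; apply/matrixP => i j; rewrite !mxE -scalemxAr linearZ.
Qed.

Lemma glue_diag (S : system) (x y z : cbasis S) :
  (glue x y == glue z z) = (x == z) && (y == z).
Proof.
apply/eqP/andP => [e|[/eqP-> /eqP->]] //; split; apply/eqP.
  by rewrite -(lpart_glue _ _ x y) e lpart_glue.
by rewrite -(rpart_glue _ _ x y) e rpart_glue.
Qed.

Lemma OmegaE (A : system) (x y : cbasis A) :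
  Omega A (enum_rank (glue x y)) 0 =
  (sqrtC (hdim A)%:R)^-1 * (x == y)%:R :> C.
Proof.
rewrite mxE; congr (_ * _); rewrite summxE.
under eq_bigr do rewrite mxE andbT (inj_eq enum_rank_inj) glue_diag.
rewrite (bigD1 x) //= eqxx big1 ?addr0 => [|z /negPf zx].
  by rewrite [y == x]eq_sym.
by rewrite eq_sym zx.
Qed.

(** The block of $|\Omega\rangle\langle\Omega|$ at $(x,x')$ is $d_A^{-1}|x\rangle\langle x'|$.
    Homogeneity pulls out $d_A^{-1}$, which cancels the normalisation of [choi]. *)
Lemma entry_choi (A B : system) (Phi : op A -> op B) x y x' y' :
  scalable Phi ->
  entry (choi Phi) (glue x y) (glue x' y') =
  entry (Phi (delta_mx (enum_rank x) (enum_rank x'))) y y'.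
Proof.
move=> hPhi; have d0 : (hdim A)%:R != 0 :> C.
  by rewrite pnatr_eq0 -lt0n hdim_gt0.
rewrite entryZ entry_mkhom !lpart_glue !rpart_glue.
have -> : mkhom (fun z w => entry (ketbra (Omega A)) (glue x z) (glue x' w)) =
    (hdim A)%:R^-1 *: delta_mx (enum_rank x) (enum_rank x') :> op A.
  apply/matrixP => i j; rewrite !mxE entry_ketbra !OmegaE rmorphM /=.
  (* The amplitude $d_A^{-1/2}$ is real, so its two copies multiply to $d_A^{-1}$. *)
  rewrite conj_Creal; last by rewrite rpredV sqrtC_real.
  rewrite conjC_nat mulrACA -invfM -expr2 sqrtCK -natrM mulnb.
  rewrite -[x == _](inj_eq enum_rank_inj) -[x' == _](inj_eq enum_rank_inj).
  by rewrite !enum_valK ![_ == enum_rank _]eq_sym.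
by rewrite hPhi entryZ mulrA mulfV // mul1r.
Qed.

(** Summing over blocks gives $\sum_{x,x'} X_{xx'}\mathrm{Tr}[Y\Phi^*(|x'\rangle\langle x|)]$.
    Moving the adjoint back onto [Y] turns each trace into $\Phi(Y)_{xx'}$; the indices come in the
    same order as in $X_{xx'}$, whence the transpose. *)
Lemma trace_tens_choi_adjoint (A B : system) (Phi : {linear op B -> op A})
    (X : op A) (Y : op B) :
  \tr (tens X Y *m choi (adjoint Phi)) = \tr (X *m (Phi Y)^T).
Proof.
rewrite !mxtrace_entry sum_cbasis_tensor; apply: eq_bigr => x _.
under eq_bigr do rewrite entryM sum_cbasis_tensor.
rewrite exchange_big entryM; apply: eq_bigr => x' _ /=.
under eq_bigr => y _.
  under eq_bigr => y' _.
    rewrite entry_mkhom !lpart_glue !rpart_glue -mulrA.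
    rewrite entry_choi; last exact: adjoint_scalable.
    over.
  rewrite -mulr_sumr -entryM; over.
by rewrite -mulr_sumr -mxtrace_entry -adjointP mxtrace_delta /entry mxE.
Qed.

Lemma ketbra_trace (S : system) (b : cbasis S) : \tr (ketbra (ket b) : op S) = 1.
Proof.
rewrite mxtrace_entry (bigD1 b) //= big1 ?addr0 => [|x /negPf xb].
  by rewrite entry_ketbra mxE !eqxx conjC1 mulr1.
by rewrite entry_ketbra mxE (inj_eq enum_rank_inj) xb mul0r.
Qed.

Lemma trace_inj_dim1 (S : system) (X Y : op S) :
  hdim S = 1%N -> \tr X = \tr Y -> X = Y.
Proof.
(* The dimension becomes a variable, so that the equation can be substituted. *)
suff H m (M N : 'M[C]_m) : m = 1%N -> \tr M = \tr N -> M = N by exact: H.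
move=> m1; subst m; rewrite /mxtrace !big_ord1 => e.
by apply/matrixP => i j; rewrite !ord1.
Qed.

End Entries.

(** * Infima and logarithms of extended reals *)

Lemma ereal_inf_above {R : realType} (y : \bar R) :
  ereal_inf [set l%:E | l in [set l : R | (y <= l%:E)%E]] = y.
Proof.
apply/eqP; rewrite eq_le; apply/andP; split; last first.
  by apply: le_ereal_inf_tmp => _ [l /= yl <-].
(* For [+oo] the bound is trivial, for [-oo] the set is all of the reals, and a real [r] attains the
   infimum. *)
case: y => [r||]; last 2 first.
- exact: leey.
- rewrite (_ : [set l : R | _] = setT) ?ereal_inf_real //.
  by apply/seteqP; split => // l _; exact: leNye.
by apply: ereal_inf_lbound; exists r => /=.
Qed.

Lemma elog2_le {R : realType} (x : \bar R) (l : R) :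
  (elog2 x <= l%:E)%E = (x <= (2 `^ l)%:E)%E.
Proof.
have ln2 : 0 < ln 2 :> R by rewrite ln_gt0 ?ltr1n.
have ln2V : (0 < ((ln 2)^-1)%:E :> \bar R)%E by rewrite lte_fin invr_gt0.
rewrite /elog2; case: x => [r||] /=; last 2 first.
- by rewrite gt0_mulye // !leye_eq.
- by rewrite gt0_mulNye // !leNye.
(* For $r \le 0$ both sides hold: [lne] takes the value [-oo] there, and $2^l$ is nonnegative. *)
have [r0|r0] := leP r 0.
  by rewrite gt0_mulNye // leNye lee_fin (le_trans r0) ?powR_ge0.
rewrite -EFinM !lee_fin ler_pdivrMr // -ln_powR ler_ln // posrE.
by rewrite powR_gt0 // ltr0n.
Qed.

Theorem mainTheorem3 (R : realType) (I : finType) (G : I -> gate R)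
    (p : {poly R}) (n : nat) (A B : system) (b : cbasis B)
    (dimB : hdim B = 1%N) (hJ : info_complete G p n A B)
    (rho : op A) (hrho : is_state rho) :
  cHmin_uncond G p n b rho = (- elog2 (comp_norm G p n b rho))%E.
Proof.
case: hrho => psd_rho _.
pose P : @op R B := ketbra (ket b).
have trP : \tr P = 1 := ketbra_trace _ b.
have -> : cHmin_uncond G p n b rho = (- cDmax G p n (tens rho P) (tens 1%:M P))%E.
  rewrite /cHmin_uncond /cHmin; congr (- _)%E.
  (* [P] is the only state of trace 1 in dimension one, so the infimum over [sigma] collapses. *)
  rewrite (_ : [set sigma : @op R B | is_state sigma] = [set P]).
    by rewrite image_set1 ereal_inf1.
  apply/seteqP; split => [sigma [_ trs]|_ ->] /=.
    by apply: trace_inj_dim1 => //; rewrite trs trP.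
  by split => //; exact: psd_ketbra.
(* With the logarithm written as the infimum of its real upper bounds, it remains to match the two
   sets of admissible [l]. *)
congr (- _)%E; rewrite -[RHS]ereal_inf_above; congr ereal_inf.
congr (image _ _); apply/seteqP.
suff E l : le_S G p n (tens rho P) ((2 `^ l)%:C%C *: tens 1%:M P) <->
    (elog2 (comp_norm G p n b rho) <= l%:E)%E.
  by split => l /= /E.
rewrite elog2_le.
have leE (Phi : {linear @op R B -> @op R A}) : is_channel Phi ->
    (\tr (tens rho P *m choi (adjoint Phi)) <=
     \tr ((2 `^ l)%:C%C *: tens 1%:M P *m choi (adjoint Phi))) =
    (complex.Re (\tr (rho *m (Phi P)^T)) <= 2 `^ l).
  move=> [posPhi trPhi].
  (* Trace preservation reduces the right-hand side to $2^l\,\mathrm{Tr}[P] = 2^l$. *)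
  rewrite -scalemxAl mxtraceZ !trace_tens_choi_adjoint mul1mx mxtrace_tr.
  rewrite trPhi trP mulr1.
  have : 0 <= \tr (rho *m (Phi P)^T).
    apply: psd_tens_trace_ge0; rewrite -id_tens_tens; apply: posPhi.
    exact: psd_tens_ketbra.
  by case: (\tr _) => x y; rewrite !lecE /= => /andP[/eqP -> _]; rewrite eqxx.
split => [le_rho|le_norm].
  apply: ge_ereal_sup => _ [_ [Phi [chPhi effPhi ->]] <-].
  rewrite lee_fin -leE //; apply: le_rho; apply: sub_gen_smallest.
  by exists Phi.
(* The operators [F] passing the test form a convex cone, so by minimality of [coneE] it suffices to
   test the generators. *)
suff: coneE G p n A B `<=` [set F | \tr (tens rho P *m F) <=
    \tr ((2 `^ l)%:C%C *: tens 1%:M P *m F)] by [].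
apply: smallest_sub.
  move=> X Y s t /= hX hY s0 t0.
  rewrite !mulmxDr -!scalemxAr !linearD !linearZ /=.
  by rewrite lerD // ler_wpM2l // ler0c.
move=> _ [Phi [chPhi effPhi ->]] /=; rewrite leE // -lee_fin.
apply: le_trans le_norm; apply: ereal_sup_ubound.
by exists (Phi P) => //; exists Phi.
Qed.
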